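(* Let $E$ be a topological real vector space, let $X \subseteq E$ be a real convex cone, and let $\preceq$ be a preorder on $X$ (not necessarily complete). Let $\tau_X$ be the topology induced on $X$ by the vector topology of $E$. Then the following conditions are equivalent: (1) There exists a nonnegative, sublinear and ($\tau_X$-)continuous order-preserving function $u : X \to \mathbb{R}$ for $\preceq$. (2) There exists a homogeneous and subadditive countable decreasing scale $\mathcal{G} = \{G_r : r \in \mathbb{Q}^{++}\}$ in $(X, \tau_X, \preceq)$ such that for every $x, y \in X$ with $x \prec y$ there exist $r_1, r_2 \in \mathbb{Q}^{++}$ with $r_1 < r_2$, $x \in G_{r_1}$ and $y \notin G_{r_2}$.
   Context: $\mathbb{Q}^{++}$ and $\mathbb{R}^{++}$ denote the sets of positive rational and positive real numbers. A preorder $\preceq$ is a reflexive and transitive binary relation; its strict part is denoted $\prec$ ($x \prec y$ iff $x \preceq y$ and not $y \preceq x$). A subset $X$ of a real vector space is a real convex cone if $tx \in X$ for all $x \in X$, $t \in \mathbb{R}^{++}$, and $x + y \in X$ for all $x, y \in X$ (the zero vector need not belong to $X$). For a subset $A$ of the vector space and real $t$, $tA = \{ta : a \in A\}$; for subsets $A, B$, $A + B = \{a + b : a \in A, b \in B\}$. A function $u : X \to \mathbb{R}$ is order-preserving for $\preceq$ if $x \preceq y$ implies $u(x) \le u(y)$ and $x \prec y$ implies $u(x) < u(y)$, for all $x, y \in X$. It is sublinear if it is homogeneous of degree one ($u(tx) = t u(x)$ for all $x \in X$, $t \in \mathbb{R}^{++}$) and subadditive ($u(x + y) \le u(x) + u(y)$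 for all $x, y \in X$). A subset $A$ of $X$ is decreasing if $y \in A$ whenever $y \preceq x$ and $x \in A$. A countable decreasing scale in $(X, \tau_X, \preceq)$ is a family $\mathcal{G} = \{G_r : r \in \mathbb{Q}^{++}\}$ such that: (i) $G_r$ is an open (in $\tau_X$) decreasing subset of $X$ for every $r \in \mathbb{Q}^{++}$; (ii) $\overline{G_{r_1}} \subseteq G_{r_2}$ for all $r_1, r_2 \in \mathbb{Q}^{++}$ with $r_1 < r_2$, where $\overline{A}$ is the closure of $A$ in $(X, \tau_X)$; (iii) $\bigcup_{r \in \mathbb{Q}^{++}} G_r = X$. It is homogeneous if $q G_r = G_{qr}$ for all $q, r \in \mathbb{Q}^{++}$, and subadditive if $G_q + G_r \subseteq G_{q + r}$ for all $q, r \in \mathbb{Q}^{++}$. *)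

(* Defs.v *)
From HB Require Import structures.
From mathcomp Require Import all_boot all_order all_algebra.
From mathcomp Require Import all_classical all_reals all_analysis.

Set Implicit Arguments.
Unset Strict Implicit.
Unset Printing Implicit Defensive.

Import Order.TTheory GRing.Theory Num.Theory.
Import numFieldNormedType.Exports.

Local Open Scope classical_set_scope.
Local Open Scope ring_scope.

(* A set [X : set E] used as a type is the subtype [set_type X], which carries
   the topology induced by [E].  It has no addition or scaling of its own, so
   identities and sets involving these operations are stated in [E]. *)

Definition convex_cone (R : realType) (E : lmodType R) (X : set E) : Prop :=
  (forall (t : R) (x : E), 0 < t -> X x -> X (t *: x)) /\
  (forall x y : E, X x -> X y -> X (x + y)).

Section Preorder.
Variables (T : Type) (le : T -> T -> Prop).

Definition strict (x y : T) : Prop := le x y /\ ~ le y x.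

Definition decreasing_set (A : set T) : Prop :=
  forall x y : T, le y x -> A x -> A y.

Definition order_preserving (R : realType) (u : T -> R) : Prop :=
  (forall x y : T, le x y -> u x <= u y) /\
  (forall x y : T, strict x y -> u x < u y).

End Preorder.

Section Sublinear.
Variables (R : realType) (E : lmodType R) (X : set E) (u : X -> R).

Definition homogeneous_fun : Prop :=
  forall (t : R) (x z : X), 0 < t -> \val z = t *: \val x -> u z = t * u x.

Definition subadditive_fun : Prop :=
  forall x y z : X, \val z = \val x + \val y -> u z <= u x + u y.

Definition sublinear : Prop := homogeneous_fun /\ subadditive_fun.

End Sublinear.

(* A scale is indexed by the positive rationals: only the values [G r] with
   [0 < r] are ever considered. *)

Definition decreasing_scale (T : topologicalType) (le : T -> T -> Prop)
    (G : rat -> set T) : Prop :=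
  [/\ forall r : rat, 0 < r -> open (G r) /\ decreasing_set le (G r),
      forall r1 r2 : rat, 0 < r1 -> r1 < r2 -> closure (G r1) `<=` G r2 &
      \bigcup_(r in [set r : rat | 0 < r]) G r = setT].

Section ConeScale.
Variables (R : realType) (E : lmodType R) (X : set E) (G : rat -> set X).

Definition homogeneous_scale : Prop :=
  forall q r : rat, 0 < q -> 0 < r ->
    [set ratr q *: \val a | a in G r] = [set \val a | a in G (q * r)].

Definition subadditive_scale : Prop :=
  forall q r : rat, 0 < q -> 0 < r ->
    [set \val a + \val b | a in G q & b in G r] `<=`
    [set \val c | c in G (q + r)].

End ConeScale.

(* Main.v *)
(* A continuous sublinear u yields the scale G r = {u < r}; conversely a scale
   yields its gauge u x = inf {r | x \in G r}.  Nesting of the scale makes the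
   gauge continuous and strictly separates x from y when x < y.  The scale is
   homogeneous only over the rationals; homogeneity of the gauge over the reals
   follows because each G r is open, so t x \in G r implies q x \in G r for some
   rational q > t, hence x \in G (r / q) and t * u x <= r. *)

Require Import Defs.
From HB Require Import structures.
From mathcomp Require Import all_boot all_order all_algebra.
From mathcomp Require Import all_classical all_reals all_analysis.

Set Implicit Arguments.
Unset Strict Implicit.
Unset Printing Implicit Defensive.

Import Order.TTheory GRing.Theory Num.Theory.
Import numFieldNormedType.Exports.

Local Open Scope classical_set_scope.
Local Open Scope ring_scope.

(** * The gauge of a decreasing scale: continuity and monotonicity *)

Section Gauge.
Variables (R : realType) (T : topologicalType) (le : T -> T -> Prop).
Variables (G : rat -> set T) (G_scale : decreasing_scale le G).

(** An analogue of the Minkowski functional. For a decreasing scale the set is nonempty by covering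
    and bounded below by 0, so [inf] never takes its default value. *)
Definition gauge (x : T) : R :=
  inf [set ratr r | r in [set r : rat | 0 < r /\ G r x]].

Lemma scale_nondecreasing (r s : rat) : 0 < r -> r <= s -> G r `<=` G s.
Proof.
case: G_scale => _ GS _ r0; rewrite le_eqVlt => /predU1P[->//|rs].
exact: subset_trans (@subset_closure _ _) (GS _ _ r0 rs).
Qed.

Lemma scale_cover (x : T) : exists2 r : rat, 0 < r & G r x.
Proof.
case: G_scale => _ _ GT; have : [set: T] x by [].
by rewrite -GT => -[r /= r0 Grx]; exists r.
Qed.

Let ratr_ge0_lbound (x : T) :
  lbound [set (ratr r : R) | r in [set r : rat | 0 < r /\ G r x]] 0.
Proof. by move=> _ [r [r0 _] <-]; rewrite ler0q ltW. Qed.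

Lemma le_gauge (x : T) (c : R) :
  (forall r : rat, 0 < r -> G r x -> c <= ratr r) -> c <= gauge x.
Proof.
move=> cP; apply: lb_le_inf; last by move=> _ [r [r0 Grx] <-]; exact: cP.
by have [r r0 Grx] := scale_cover x; exists (ratr r); exists r.
Qed.

Lemma gauge_ge0 (x : T) : 0 <= gauge x.
Proof. by apply: le_gauge => r r0 _; rewrite ler0q ltW. Qed.

Lemma gauge_le (x : T) (r : rat) : 0 < r -> G r x -> gauge x <= ratr r.
Proof.
move=> r0 Grx; apply: ge_inf; first by exists 0; exact: ratr_ge0_lbound.
by exists r.
Qed.

Lemma gauge_lt (x : T) (c : R) : gauge x < c ->
  exists2 r : rat, 0 < r /\ G r x & ratr r < c.
Proof.
move=> /inf_lt[|_ [r rP <-] rc]; last by exists r.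
by have [r r0 Grx] := scale_cover x; exists (ratr r); exists r.
Qed.

(** Some index below [r] already captures [x], and the scale grows with its index. Together with
    [gauge_le], this squeezes [G r] between the strict and the large sublevel sets of the gauge. *)
Lemma gauge_lt_ratr (x : T) (r : rat) : gauge x < ratr r -> G r x.
Proof.
move=> /gauge_lt[s [s0 Gsx]]; rewrite ltr_rat => sr.
exact: scale_nondecreasing s0 (ltW sr) _ Gsx.
Qed.

(** The closure of [G r] lies in [G q] for every rational [q > r], and such [q] come arbitrarily
    close to [r]. *)
Lemma gauge_le_closure (x : T) (r : rat) :
  0 < r -> closure (G r) x -> gauge x <= ratr r.
Proof.
case: G_scale => _ GS _ r0 clGx; apply/ler_addgt0Pr => e e0.
have [q] : exists q : rat, (ratr q : R) \in `](ratr r), (ratr r + e)[.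
  by apply: rat_in_itvoo; rewrite ltrDl.
rewrite in_itv /= ltr_rat => /andP[rq qe].
by apply: le_trans (ltW qe); apply: gauge_le (lt_trans r0 rq) (GS _ _ r0 rq _ clGx).
Qed.

Lemma gauge_continuous : continuous gauge.
Proof.
move=> x; apply/cvgrPdist_lt => e e0.
(* Upper semicontinuity: an open [G r] with [r < gauge x + e] is the neighbourhood. *)
have upper : \forall y \near x, gauge y < gauge x + e.
  have [r [r0 Grx] re] : exists2 r : rat, 0 < r /\ G r x & ratr r < gauge x + e.
    by apply: gauge_lt; rewrite ltrDl.
  case: G_scale => /(_ r r0)[Go _] _ _.
  have : nbhs x (G r) by exact: open_nbhs_nbhs.
  by apply: filterS => y Gry; exact: le_lt_trans (gauge_le r0 Gry) re.
have lower : \forall y \near x, gauge x - e < gauge y.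
  (* A negative bound is trivial since the gauge is nonnegative; otherwise a rational above it is
     positive, hence a legitimate index. *)
  have [xe|xe] := ltP (gauge x - e) 0.
    by apply: nearW => y; exact: lt_le_trans xe (gauge_ge0 y).
  have [q] : exists q : rat, (ratr q : R) \in `](gauge x - e), (gauge x)[.
    by apply: rat_in_itvoo; rewrite ltrBlDr ltrDl.
  rewrite in_itv /= => /andP[eq qx].
  have q0 : 0 < q by rewrite -(ltr0q R); exact: le_lt_trans xe eq.
  (* Lower semicontinuity: [q < gauge x] puts [x] outside the closure of [G q], and outside [G q]
     the gauge is at least [q]. *)
  have : nbhs x (~` closure (G q)).
    apply: open_nbhs_nbhs; split; first exact/closed_openC/closed_closure.
    by move=> /(gauge_le_closure q0); rewrite leNgt qx.
  apply: filterS => y nGy; apply: lt_le_trans eq _.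
  by rewrite leNgt; apply/negP => /gauge_lt_ratr Gqy; apply: nGy; exact: subset_closure.
near=> y; rewrite distrC ltr_distl; apply/andP; split; near: y; exact.
Unshelve. all: by end_near. Qed.

Lemma gauge_order_preserving :
  (forall x y, strict le x y -> exists r1 r2 : rat,
     [/\ 0 < r1, 0 < r2, r1 < r2, G r1 x & ~ G r2 y]) ->
  order_preserving le gauge.
Proof.
move=> Gsep; split=> x y.
  move=> xy; apply: le_gauge => r r0 Gry; apply: gauge_le => //.
  by case: G_scale => /(_ r r0)[_ Gdec] _ _; exact: Gdec xy Gry.
move=> /Gsep[r1 [r2 [r10 r20 r12 Gx nGy]]].
(* The gap between the indices gives strictness: [gauge x <= r1 < r2 <= gauge y]. *)
apply: le_lt_trans (gauge_le r10 Gx) _.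
apply: lt_le_trans (_ : ratr r2 <= _); first by rewrite ltr_rat.
by rewrite leNgt; apply/negP => /gauge_lt_ratr.
Qed.

End Gauge.

(** * Sublinearity of the gauge on a cone *)

Section ConeGauge.
Variables (R : realType) (E : topologicalLmodType R) (X : set E).
Hypothesis X_cone : convex_cone X.
Variables (le : X -> X -> Prop) (G : rat -> set X).
Hypotheses (G_scale : decreasing_scale le G) (G_hom : homogeneous_scale G).

(** [A] is the trace on [X] of an open set of [E], which the continuous ray [s *: \val x] does not
    leave for [s] slightly above [t]; the cone property keeps the ray in [X]. *)
Lemma open_cone_scaleP (A : set X) (x z : X) (t : R) : open A -> A z ->
  0 < t -> \val z = t *: \val x ->
  exists q : rat, [/\ 0 < q, t < ratr q &
    exists2 y : X, A y & \val y = ratr q *: \val x].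
Proof.
move=> [W Wo <-] /= Wz t0 zE.
have nW : nbhs (t *: \val x) W by rewrite -zE; exact: open_nbhs_nbhs.
have scx : {for t, continuous (fun s : R^o => s *: \val x)}.
  apply: (@continuous_comp R^o (R^o * E)%type E (fun s => (s, \val x))
    (fun z => z.1 *: z.2)); last exact: scale_continuous.
  by apply: (@cvg_pair _ _ _ _ (nbhs (t : R^o)) (nbhs (\val x)) _ _ _ id);
    [exact: cvg_id|exact: cvg_cst].
have /nbhs_ballP[e /= e0 eW] := scx _ nW.
have [q] : exists q : rat, (ratr q : R) \in `]t, (t + e)[.
  by apply: rat_in_itvoo; rewrite ltrDl.
rewrite in_itv /= => /andP[tq qe].
have q0 : 0 < (ratr q : R) := lt_trans t0 tq.
have Xqx : X (ratr q *: \val x).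
  by apply: X_cone.1 => //; exact: set_valP.
exists q; split=> //; first by rewrite ltr0q in q0.
exists (SigSub (mem_set Xqx)) => //=.
by apply: eW; rewrite /ball /= distrC gtr0_norm ?subr_gt0// ltrBlDl.
Qed.

Let scale_div (q r : rat) (x y : X) : 0 < q -> 0 < r -> G r y ->
  \val y = ratr q *: \val x -> G (r / q) x.
Proof.
move=> q0 r0 Gy yE.
have : [set \val a | a in G (q * (r / q))] (\val y).
  by exists y => //; rewrite mulrC divfK ?gt_eqF.
rewrite -G_hom ?divr_gt0// => -[a Ga]; rewrite yE => /scalerI.
rewrite fmorph_eq0 gt_eqF// => /(_ isT) ax.
by have <- : a = x by exact: val_inj.
Qed.

Let gauge_scale_ge (t : R) (x z : X) : 0 < t -> \val z = t *: \val x ->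
  t * gauge R G x <= gauge R G z.
Proof.
move=> t0 zE; apply: (le_gauge G_scale) => r r0 Grz.
have [Go _] : open (G r) /\ decreasing_set le (G r) by case: G_scale => /(_ r r0).
have [q [q0 tq [y Gry yE]]] := open_cone_scaleP Go Grz t0 zE.
(* From [gauge x <= r / q] and [t < q] follows [t * gauge x <= q * gauge x <= r]. *)
have := gauge_le R (divr_gt0 r0 q0) (scale_div q0 r0 Gry yE).
rewrite fmorph_div /= ler_pdivlMr ?ltr0q//; apply: le_trans.
by rewrite mulrC ler_wpM2l ?(ltW tq)//; exact: gauge_ge0 G_scale _.
Qed.

Lemma gauge_homogeneous : homogeneous_fun (gauge R G).
Proof.
move=> t x z t0 zE; apply/eqP; rewrite eq_le gauge_scale_ge// andbT.
(* The reverse inequality is the same bound for the factor [t^-1], with [x] and [z] exchanged. *)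
rewrite -ler_pdivrMl// gauge_scale_ge ?invr_gt0//.
by rewrite zE scalerA mulVf ?gt_eqF// scale1r.
Qed.

Lemma gauge_subadditive : subadditive_scale G -> subadditive_fun (gauge R G).
Proof.
move=> G_sub x y z zE; apply/ler_addgt0Pr => e e0.
have e20 : 0 < e / 2 by rewrite divr_gt0.
have [q [q0 Gqx] qe] : exists2 q : rat, 0 < q /\ G q x &
    ratr q < gauge R G x + e / 2 by apply: (gauge_lt G_scale); rewrite ltrDl.
have [r [r0 Gry] re] : exists2 r : rat, 0 < r /\ G r y &
    ratr r < gauge R G y + e / 2 by apply: (gauge_lt G_scale); rewrite ltrDl.
have [c Gc cE] : [set \val c | c in G (q + r)] (\val z).
  by apply: G_sub => //; exists x => //; exists y.
have <- : c = z by exact: val_inj.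
apply: le_trans (gauge_le R (addr_gt0 q0 r0) Gc) _.
by rewrite rmorphD /= [e]splitr addrACA ltW// ltrD.
Qed.

End ConeGauge.

(** * The scale of strict sublevel sets of a function *)

Definition sublevel (R : realType) (T : Type) (u : T -> R) (r : rat) : set T :=
  [set x | u x < ratr r].

Section SublevelScale.
Variables (R : realType) (T : topologicalType) (le : T -> T -> Prop).
Variables (u : T -> R).

Lemma sublevel_decreasing_scale : continuous u ->
  (forall x y, le x y -> u x <= u y) -> decreasing_scale le (sublevel u).
Proof.
move=> uC u_le; split.
- move=> r r0; split; last by move=> x y /u_le; exact: le_lt_trans.
  by apply: open_comp (@open_lt _ _) => x _; exact: uC.
- move=> r s r0 rs x clx.
  (* Nesting: the closed large sublevel set at [r] separates the strict ones at [r] and [s]. *)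
  have clr : closed [set x | u x <= ratr r].
    by apply: closed_comp (@closed_le _ _) => y _; exact: uC.
  have : closure [set x | u x <= ratr r] x.
    by apply: closureS clx => y; exact: ltW.
  by rewrite -(iffLR (closure_id _) clr) => /le_lt_trans; apply; rewrite ltr_rat.
- rewrite -subTset => x _.
  (* The maximum with 0 forces the index [q] to be positive whatever the sign of [u x]. *)
  have [q] : exists q : rat,
      (ratr q : R) \in `](Num.max 0 (u x)), (Num.max 0 (u x) + 1)[.
    by apply: rat_in_itvoo; rewrite ltrDl.
  by rewrite in_itv /= gt_max ltr0q => /andP[/andP[q0 uq] _]; exists q.
Qed.

End SublevelScale.

Section ConeSublevel.
Variables (R : realType) (E : lmodType R) (X : set E) (u : X -> R).
Hypothesis X_cone : convex_cone X.

Lemma sublevel_homogeneous : homogeneous_fun u -> homogeneous_scale (sublevel u).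
Proof.
move=> u_hom q r q0 r0; have q0R : 0 < (ratr q : R) by rewrite ltr0q.
apply/seteqP; split=> [_ [a ua <-]|_ [a ua <-]].
  have Xqa : X (ratr q *: \val a) by apply: X_cone.1 => //; exact: set_valP.
  exists (SigSub (mem_set Xqa)) => //; rewrite /sublevel /=.
  by rewrite (u_hom (ratr q) a)// rmorphM ltr_pM2l.
have Xqa : X ((ratr q)^-1 *: \val a).
  by apply: X_cone.1; rewrite ?invr_gt0//; exact: set_valP.
exists (SigSub (mem_set Xqa)); last first.
  by rewrite /= scalerA mulfV ?gt_eqF// scale1r.
rewrite /sublevel /= (u_hom (ratr q)^-1 a) ?invr_gt0// ltr_pdivrMl//.
by rewrite -rmorphM.
Qed.

Lemma sublevel_subadditive : subadditive_fun u -> subadditive_scale (sublevel u).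
Proof.
move=> u_sub q r q0 r0 _ [a ua [b ub <-]].
have Xab : X (\val a + \val b) by apply: X_cone.2; exact: set_valP.
exists (SigSub (mem_set Xab)) => //; rewrite /sublevel /= rmorphD /=.
by apply: le_lt_trans (u_sub a b _ _) _ => //; exact: ltrD.
Qed.

End ConeSublevel.

Theorem theorem3p1 (R : realType) (E : topologicalLmodType R) (X : set E)
    (le : X -> X -> Prop) (X_cone : convex_cone X)
    (le_preorder : RelationClasses.PreOrder le) :
  (exists u : X -> R,
     [/\ forall x : X, 0 <= u x,
         sublinear u,
         continuous u &
         order_preserving le u])
  <->
  (exists G : rat -> set X,
     [/\ decreasing_scale le G,
         homogeneous_scale G,
         subadditive_scale G &
         forall x y : X, strict le x y ->
           exists r1 r2 : rat,
             [/\ 0 < r1, 0 < r2, r1 < r2, G r1 x & ~ G r2 y]]).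
Proof.
split=> [[u [u0 [u_hom u_sub] uC [u_le u_lt]]]|[G [G_scale G_hom G_sub G_sep]]].
  exists (sublevel u); split.
  - exact: sublevel_decreasing_scale.
  - exact: sublevel_homogeneous.
  - exact: sublevel_subadditive.
  - move=> x y /u_lt uxy.
    (* Two rationals [u x < r < s < u y] separate [x] from [y]; nonnegativity of [u] makes them
       positive. *)
    have [s] := rat_in_itvoo uxy; rewrite in_itv /= => /andP[us su].
    have [r] := rat_in_itvoo us; rewrite in_itv /= => /andP[ur rs].
    have r0 : 0 < r by rewrite -(ltr0q R); exact: le_lt_trans (u0 x) ur.
    rewrite ltr_rat in rs; exists r, s; split=> //; first exact: lt_trans rs.
    by apply/negP; rewrite -leNgt ltW.
exists (gauge R G); split.
- exact: gauge_ge0 G_scale.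
- split; first exact: gauge_homogeneous G_scale G_hom.
  exact: gauge_subadditive G_scale G_sub.
- exact: gauge_continuous G_scale.
- exact: gauge_order_preserving.
Qed.
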